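(* Let $m \le n$, $A \in \mathbb{R}^{m\times n}$, $Q \in \mathbb{R}^{n\times n}$ symmetric positive semi-definite, $\delta,\rho>0$, integers $0\le k_c\le n$ and $0\le k_r\le m$, and permutation matrices $\mathscr{P}_c\in\mathbb{R}^{n\times n}$, $\mathscr{P}_r\in\mathbb{R}^{m\times m}$ be given. Let $$K = \begin{bmatrix} -(Q+\rho I_n) & A^\top\\ A & \delta I_m\end{bmatrix}, \qquad P_{AS} = \begin{bmatrix} \widehat{F} & 0_{n,m}\\ 0_{m,n} & P_{NE}\end{bmatrix},$$ where $\widehat{F}$, $P_{NE}=P_{NE,(k_c,k_r)}$ and the scalars $\alpha_{NE},\beta_{NE},\alpha_F,\beta_F$ are defined from these data as in the context. Then the eigenvalues of $P_{AS}^{-1}K$ lie in the union $I_-\cup I_+$ of the intervals $$ I_- = \left[- \beta_{F} -\sqrt{\beta_{NE}},\ -\alpha_{F}\right], \qquad I_+ = \left[\frac{1}{2}\left( -\beta_{F} + \sqrt{\beta_{F}^2 + 4\alpha_{NE}}\right),\ 1 + \sqrt{\beta_{NE}-1}\right].$$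
   Context: Notation: $I_k$ is the $k\times k$ identity, $0_{p,q}$ the $p\times q$ zero matrix, $\mathrm{Diag}(N)$ the diagonal matrix with the same diagonal entries as $N$; $\lambda_{\min},\lambda_{\max}$ denote the minimum and maximum eigenvalue of a square matrix with real eigenvalues. Approximation of $Q$: write $$Q = \mathscr{P}_c \begin{bmatrix} Q_1 & Q_3^\top\\ Q_3 & Q_2 \end{bmatrix}\mathscr{P}_c^\top, \qquad Q_1\in\mathbb{R}^{k_c\times k_c},\quad Q_2\in\mathbb{R}^{(n-k_c)\times(n-k_c)},$$ and set $$\widehat{Q} = \mathscr{P}_c\begin{bmatrix} \widehat{Q}_1 & 0_{k_c,n-k_c}\\ 0_{n-k_c,k_c} & \widehat{Q}_2 \end{bmatrix} \mathscr{P}_c^\top,$$ where $\widehat{Q}_1$ is either $Q_1$ or $\mathrm{Diag}(Q_1)$, and $\widehat{Q}_2$ is either $Q_2$ or $\mathrm{Diag}(Q_2)$ (any of these choices is allowed). Set $F = Q+\rho I_n$, $\widehat{F} = \widehat{Q}+\rho I_n$, $\widehat{G}=\widehat{F}^{-1}$, and $\widehat{M} = A\widehat{F}^{-1}A^\top + \delta I_m$. Normal equations preconditioner: let $$B = \mathscr{P}_r A \widehat{G}^{1/2}\mathscr{P}_c = \begin{bmatrix} B_{11}& B_{12} \\ B_{21} & B_{22} \end{bmatrix},$$ with $B_{11} \in \mathbb{R}^{k_r \times k_c}$, $B_{12} \in \mathbb{R}^{k_r \times (n-k_c)}$, $B_{21} \in \mathbb{R}^{(m-k_r)\times k_c}$,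 $B_{22} \in \mathbb{R}^{(m-k_r)\times(n-k_c)}$. Let $\widehat{M}_{11} = B_{11}B_{11}^\top + B_{12}B_{12}^\top + \delta I_{k_r}$, $\widehat{M}_{22} = B_{21}B_{21}^\top + B_{22}B_{22}^\top + \delta I_{m-k_r}$ (the diagonal blocks of $\mathscr{P}_r\widehat{M}\mathscr{P}_r^\top$), and $\widetilde{M}_{22} = \widehat{M}_{22} - B_{21}B_{21}^\top$. Then $$P_{NE} = P_{NE,(k_c,k_r)} = \begin{bmatrix} \widehat{M}_{11} & 0_{k_r, m-k_r} \\ 0_{m-k_r,k_r} & \widetilde{M}_{22} \end{bmatrix}.$$ Blocks with a zero dimension are absent, and a product $XX^\top$ with $X$ having no columns is the zero matrix (e.g. if $k_r=0$ then $P_{NE}=\widetilde{M}_{22}$). Scaled matrices (using symmetric positive definite square roots): $$\widetilde{F} = \widehat{F}^{-1/2} F \widehat{F}^{-1/2}, \qquad \widetilde{M}_{NE} = P_{NE}^{-1/2}\widehat{M}P_{NE}^{-1/2},$$ and $$\alpha_{NE}=\lambda_{\min}(\widetilde{M}_{NE}),\quad \beta_{NE}=\lambda_{\max}(\widetilde{M}_{NE}),\quad \alpha_F=\lambda_{\min}(\widetilde{F}),\quad \beta_F=\lambda_{\max}(\widetilde{F}).$$ *)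

(* Defs.v *)
From mathcomp Require Import all_boot all_order all_algebra.
From mathcomp Require Import classical_sets reals complex.

Set Implicit Arguments.
Unset Strict Implicit.
Unset Printing Implicit Defensive.

Import Order.TTheory GRing.Theory Num.Theory.
Local Open Scope ring_scope.

Section SymmetricMatrices.
Variable R : realType.

Definition psd n (N : 'M[R]_n) : Prop :=
  N^T = N /\ forall x : 'cV[R]_n, 0 <= (x^T *m N *m x) ord0 ord0.

Definition spd n (N : 'M[R]_n) : Prop :=
  N^T = N /\ forall x : 'cV[R]_n, x != 0 -> 0 < (x^T *m N *m x) ord0 ord0.

(* The symmetric positive definite S with S^2 = N; it exists and is unique
   when N is symmetric positive definite, and is 0 by convention if there is
   none. *)
Definition spd_sqrt n (N : 'M[R]_n) : 'M[R]_n :=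
  xget 0 [set S : 'M[R]_n | spd S /\ S *m S = N]%classic.

Definition spd_isqrt n (N : 'M[R]_n) : 'M[R]_n := invmx (spd_sqrt N).

(* 0 by convention if N has no real eigenvalue (e.g. in dimension 0). *)
Definition lambda_min n (N : 'M[R]_n) : R :=
  xget 0 [set a : R | eigenvalue N a /\
                      forall b, eigenvalue N b -> a <= b]%classic.

Definition lambda_max n (N : 'M[R]_n) : R :=
  xget 0 [set a : R | eigenvalue N a /\
                      forall b, eigenvalue N b -> b <= a]%classic.

Definition Diag n (N : 'M[R]_n) : 'M[R]_n := diag_mx (\row_i N i i).

Definition maybe_Diag (d : bool) n (N : 'M[R]_n) : 'M[R]_n :=
  if d then Diag N else N.

End SymmetricMatrices.

(* The dimensions are n = kc + nc and m = kr + mr, so that nc and mr stand for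
   n - kc and m - kr, and the 2 x 2 block partitions are carried by the types. *)
Section Preconditioner.
Variables (R : realType) (kc nc kr mr : nat).

(* Since Pc is orthogonal, Pc^T *m Q *m Pc is the matrix whose blocks are
   Q1, Q3^T, Q3, Q2 in Q = Pc *m block_mx Q1 Q3^T Q3 Q2 *m Pc^T.  The booleans
   d1 and d2 say whether Q1, resp. Q2, is replaced by its diagonal. *)
Definition Qhat (d1 d2 : bool) (Pc Q : 'M[R]_(kc + nc)) : 'M[R]_(kc + nc) :=
  let Qp := Pc^T *m Q *m Pc in
  Pc *m block_mx (maybe_Diag d1 (ulsubmx Qp)) 0
                 0 (maybe_Diag d2 (drsubmx Qp)) *m Pc^T.

Definition Mhat (A : 'M[R]_(kr + mr, kc + nc)) (Fhat : 'M[R]_(kc + nc))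
    (delta : R) : 'M[R]_(kr + mr) :=
  A *m invmx Fhat *m A^T + delta%:M.

Definition P_NE (A : 'M[R]_(kr + mr, kc + nc)) (Fhat : 'M[R]_(kc + nc))
    (delta : R) (Pc : 'M[R]_(kc + nc)) (Pr : 'M[R]_(kr + mr)) :
    'M[R]_(kr + mr) :=
  let Ghat := invmx Fhat in
  let B : 'M[R]_(kr + mr, kc + nc) := Pr *m A *m spd_sqrt Ghat *m Pc in
  let B11 := ulsubmx B in let B12 := ursubmx B in
  let B21 := dlsubmx B in let B22 := drsubmx B in
  let Mhat11 := B11 *m B11^T + B12 *m B12^T + delta%:M in
  let Mhat22 := B21 *m B21^T + B22 *m B22^T + delta%:M in
  let Mtilde22 := Mhat22 - B21 *m B21^T in
  block_mx Mhat11 0 0 Mtilde22.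

End Preconditioner.

(* Main.v *)
Require Import Defs.
From mathcomp Require Import all_boot all_order fingroup perm all_algebra.
From mathcomp Require Import classical_sets reals complex.
From mathcomp Require Import ring lra.

Import Order.TTheory GRing.Theory Num.Theory.
Local Open Scope ring_scope.
Local Open Scope complex_scope.

(** Write [Fhat] and [P] for the two diagonal blocks of the preconditioner.
An eigenpair of the preconditioned matrix is a solution of
    - F x + A^T y = z Fhat x,      A x + delta y = z P y,
that is, an eigenpair of the pencil of a symmetric matrix against a positive
definite one; hence [z = l] is real and [x], [y] can be taken real
([real_pencil]).  Pairing the equations with [x] and [y] gives
    c = l f + a,      c + e = l p
for the numbers
    a = x^T F x,   f = x^T Fhat x,   c = y^T A x,
    e = delta |y|^2,   p = y^T P y,   g = y^T A Fhat^-1 A^T y,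
and everything else is a comparison of these six numbers.

The extreme eigenvalues of the scaled matrices enter as Rayleigh bounds:
[alphaF f <= a <= betaF f] and [alphaNE p <= g + e <= betaNE p]
([scaled_rayleigh_bounds]).  Three more facts link the numbers:
[c^2 <= f g], by Cauchy-Schwarz for [Fhat]; [e <= p], since [P - delta] is a
sum of Gram matrices; and [g <= (l + betaF) c] when [l > 0], by Cauchy-Schwarz
for [l Fhat + F].

- If [l <= - alphaF] and [m = - l] exceeds [betaF], both [(m - betaF) f] and
  [m p] are at most [- c], so [c^2 <= f g <= betaNE f p] forces
  [m (m - betaF) <= betaNE].
- If [l > - alphaF] then [c >= 0], so [l > 0].  From [g <= (l + betaF) c] and
  [betaF >= 1] follows [l (l + betaF) >= alphaNE], and from [l c <= g] and
  [e <= p] follows [(l - 1)^2 <= betaNE - 1] when [l > 1].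

That [betaF >= 1] holds because [Fhat] keeps the diagonal of [F] in permuted
coordinates, so the two forms agree on some nonzero vector.

Behind the Rayleigh bounds and the square roots is the spectral measure of a
symmetric matrix ([spectral_measure]), read off from the unitary
diagonalization of its complexification. *)

Section Preconditioning.

Set Implicit Arguments.
Unset Strict Implicit.
Unset Printing Implicit Defensive.

Variable R : realType.

(** * Bilinear forms and positive definiteness *)

Definition bform p q (N : 'M[R]_(p, q)) (u : 'cV_p) (v : 'cV_q) : R :=
  (u^T *m N *m v) ord0 ord0.

Lemma bformE p q (N : 'M[R]_(p, q)) u v :
  bform N u v = (u^T *m (N *m v)) ord0 ord0.
Proof. by rewrite /bform mulmxA. Qed.

Lemma bform_mulr p q (N : 'M[R]_(p, q)) u v :
  bform N u v = bform 1%:M u (N *m v).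
Proof. by rewrite !bformE mul1mx. Qed.

Lemma bform_tr p q (N : 'M[R]_(p, q)) u v : bform N^T v u = bform N u v.
Proof.
by rewrite /bform -[u^T *m N *m v]trmxK [RHS]mxE !trmx_mul trmxK mulmxA.
Qed.

Lemma bformDl p q (N : 'M[R]_(p, q)) u u' v :
  bform N (u + u') v = bform N u v + bform N u' v.
Proof. by rewrite /bform linearD !mulmxDl mxE. Qed.

Lemma bformDr p q (N : 'M[R]_(p, q)) u v v' :
  bform N u (v + v') = bform N u v + bform N u v'.
Proof. by rewrite /bform mulmxDr mxE. Qed.

Lemma bformZl p q (N : 'M[R]_(p, q)) a u v :
  bform N (a *: u) v = a * bform N u v.
Proof. by rewrite /bform linearZ /= -!scalemxAl mxE. Qed.

Lemma bformZr p q (N : 'M[R]_(p, q)) a u v :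
  bform N u (a *: v) = a * bform N u v.
Proof. by rewrite /bform -!scalemxAr mxE. Qed.

Lemma bformD p q (N N' : 'M[R]_(p, q)) u v :
  bform (N + N') u v = bform N u v + bform N' u v.
Proof. by rewrite /bform mulmxDr mulmxDl mxE. Qed.

Lemma bformN p q (N : 'M[R]_(p, q)) u v : bform (- N) u v = - bform N u v.
Proof. by rewrite /bform mulmxN mulNmx mxE. Qed.

Lemma bformZ p q a (N : 'M[R]_(p, q)) u v :
  bform (a *: N) u v = a * bform N u v.
Proof. by rewrite /bform -scalemxAr -scalemxAl mxE. Qed.

Lemma bform0 p q u v : bform (0 : 'M_(p, q)) u v = 0.
Proof. by rewrite /bform mulmx0 mul0mx mxE. Qed.

Lemma bform0l p q (N : 'M[R]_(p, q)) v : bform N 0 v = 0.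
Proof. by rewrite /bform trmx0 !mul0mx mxE. Qed.

Lemma bform0r p q (N : 'M[R]_(p, q)) u : bform N u 0 = 0.
Proof. by rewrite /bform mulmx0 mxE. Qed.

Lemma bform_mul p q r s (X : 'M[R]_(p, q)) (N : 'M_(q, r)) (Y : 'M_(r, s)) u v :
  bform (X *m N *m Y) u v = bform N (X^T *m u) (Y *m v).
Proof. by rewrite /bform trmx_mul trmxK !mulmxA. Qed.

Lemma bform1_mul p q r (X : 'M[R]_(p, q)) (Y : 'M_(p, r)) u v :
  bform 1%:M (X *m u) (Y *m v) = bform (X^T *m Y) u v.
Proof. by rewrite -[X^T]mulmx1 bform_mul trmxK. Qed.

Lemma bform_scalar p a (u v : 'cV_p) : bform a%:M u v = a * bform 1%:M u v.
Proof. by rewrite -bformZ scalemx1. Qed.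

Lemma bform1E p (u : 'cV_p) : bform 1%:M u u = \sum_i u i ord0 ^+ 2.
Proof.
by rewrite /bform mulmx1 mxE; apply: eq_bigr => i _; rewrite mxE expr2.
Qed.

Lemma bform1_ge0 p (u : 'cV_p) : 0 <= bform 1%:M u u.
Proof. by rewrite bform1E sumr_ge0 // => i _; rewrite sqr_ge0. Qed.

Lemma bform1_eq0 p (u : 'cV_p) : bform 1%:M u u = 0 -> u = 0.
Proof.
rewrite bform1E => /eqP; rewrite psumr_eq0 => [/allP h|i _]; last exact: sqr_ge0.
apply/colP => i; apply/eqP; rewrite mxE -sqrf_eq0.
by apply: (implyP (h i _)); rewrite ?mem_index_enum.
Qed.

Lemma bform_block p q r s (Z : 'M[R]_(p, r)) (A : 'M_(p, s)) (B : 'M_(q, r))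
    (D : 'M_(q, s)) x y x' y' :
  bform (block_mx Z A B D) (col_mx x y) (col_mx x' y') =
  bform Z x x' + bform A x y' + (bform B y x' + bform D y y').
Proof.
rewrite bformE tr_col_mx mul_block_col mul_row_col !mulmxDr !mulmxA.
by rewrite /bform !mxE.
Qed.

Lemma bform_mxE n (N : 'M[R]_n) i :
  bform N (delta_mx i ord0) (delta_mx i ord0) = N i i.
Proof. by rewrite bformE -colE trmx_delta -rowE !mxE. Qed.

(** The form is nonnegative on every combination of [u] and [v], so its
discriminant is nonpositive. *)
Lemma psd_cauchy_schwarz n (N : 'M[R]_n) (hN : psd N) u v :
  bform N u v ^+ 2 <= bform N u u * bform N v v.
Proof.
case: hN => hT h0; have sym x y : bform N x y = bform N y x.
  by rewrite -{1}hT bform_tr.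
have h0u : 0 <= bform N u u := h0 u.
have h0v : 0 <= bform N v v := h0 v.
have q (s t : R) :
    0 <= s ^+ 2 * bform N u u + 2 * (s * t * bform N u v) + t ^+ 2 * bform N v v.
  have := h0 (s *: u + t *: v); rewrite -/(bform _ _ _).
  rewrite bformDl !bformDr !bformZl !bformZr (sym v u) => h.
  by apply: le_trans h _; rewrite le_eqVlt; apply/orP; left; apply/eqP; ring.
move: q h0u h0v.
move: (bform N u u) (bform N u v) (bform N v v) => a b c q h0u h0v.
have [c0|c0] := eqVneq c 0.
  (* With c = 0 the values are b^2 (a - 2 (a + 1)) = - b^2 (a + 2). *)
  have := q b (- (a + 1)); rewrite c0; nra.
have c1 : 0 < c by rewrite lt_def c0.
have := q c (- b).
have -> : c ^+ 2 * a + 2 * (c * - b * b) + (- b) ^+ 2 * c = c * (a * c - b ^+ 2).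
  by ring.
by rewrite pmulr_rge0 // subr_ge0.
Qed.

Lemma spd_psd n (N : 'M[R]_n) : spd N -> psd N.
Proof.
case=> hT h; split=> // x; have [->|/h/ltW//] := eqVneq x 0.
by rewrite mulmx0 mxE.
Qed.

Lemma spd_unitmx n (N : 'M[R]_n) : spd N -> N \in unitmx.
Proof.
case=> _ h; rewrite -row_free_unit -kermx_eq0; apply/eqP/row_matrixP => i.
rewrite row0; apply/trmx_inj; rewrite trmx0; apply/eqP/negPn/negP => /h.
rewrite trmxK -row_mul mulmx_ker row0 mul0mx mxE.
by rewrite ltxx.
Qed.

Lemma spd_inv n (N : 'M[R]_n) : spd N -> spd (invmx N).
Proof.
move=> hN; have uN := spd_unitmx hN; case: (hN) => hT h.
have hV : (invmx N)^T = invmx N by rewrite trmx_inv hT.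
split=> // x x0; rewrite -/(bform _ _ _).
have -> : invmx N = invmx N *m N *m invmx N by rewrite mulVmx // mul1mx.
rewrite bform_mul hV; apply: h; apply: contraNneq x0 => h0.
by rewrite -[x](mulKVmx uN) h0 mulmx0.
Qed.

Lemma spd1 n : spd (1%:M : 'M[R]_n).
Proof.
split=> [|x x0]; first by rewrite trmx1.
rewrite -/(bform _ _ _) lt_def bform1_ge0 andbT.
by apply: contra_neq x0; apply: bform1_eq0.
Qed.

Lemma spd_add_scalar n (N : 'M[R]_n) r : psd N -> 0 < r -> spd (N + r%:M).
Proof.
case=> hT h r0; split=> [|x x0]; first by rewrite linearD /= hT tr_scalar_mx.
rewrite -/(bform _ _ _) bformD bform_scalar ltr_wpDl ?h ?mulr_gt0 //.
have [_ h1] := spd1 n; exact: h1.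
Qed.

Lemma psd_gram p q (X : 'M[R]_(p, q)) : psd (X *m X^T).
Proof.
split=> [|x]; first by rewrite trmx_mul trmxK.
by rewrite -/(bform _ _ _) -{1}[X]mulmx1 bform_mul bform1_ge0.
Qed.

Lemma psdD n (N N' : 'M[R]_n) : psd N -> psd N' -> psd (N + N').
Proof.
case=> hT h [hT' h']; split=> [|x]; first by rewrite linearD /= hT hT'.
by rewrite -/(bform _ _ _) bformD addr_ge0 ?h ?h'.
Qed.

Lemma psd_congr p q (X : 'M[R]_(p, q)) N : psd N -> psd (X *m N *m X^T).
Proof.
case=> hT h; split=> [|x]; first by rewrite !trmx_mul trmxK hT mulmxA.
by rewrite -/(bform _ _ _) bform_mul h.
Qed.

Lemma psd_block p q (N : 'M[R]_p) (N' : 'M[R]_q) :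
  psd N -> psd N' -> psd (block_mx N 0 0 N').
Proof.
case=> hT h [hT' h']; split=> [|x]; first by rewrite tr_block_mx hT hT' !trmx0.
rewrite -/(bform _ _ _) -[x]vsubmxK bform_block.
by rewrite !bform0 addr0 add0r addr_ge0 ?h ?h'.
Qed.

Lemma spd_block p q (N : 'M[R]_p) (N' : 'M[R]_q) :
  spd N -> spd N' -> spd (block_mx N 0 0 N').
Proof.
move=> hN hN'; have [hT _] := psd_block (spd_psd hN) (spd_psd hN').
split=> // x; rewrite -[x]vsubmxK col_mx_eq0 negb_and => x0.
rewrite -/(bform _ _ _) bform_block !bform0 addr0 add0r.
have [_ g] := hN; have [_ g'] := hN'.
have [_ h] := spd_psd hN; have [_ h'] := spd_psd hN'.
have := h (usubmx x); have := h' (dsubmx x); rewrite -!/(bform _ _ _).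
by case/orP: x0 => [/g|/g']; rewrite -/(bform _ _ _) => *; lra.
Qed.

Lemma psd_Diag n (N : 'M[R]_n) : psd N -> psd (Diag N).
Proof.
case=> hT h; split=> [|x]; first by rewrite tr_diag_mx.
rewrite mxE sumr_ge0 // => i _; rewrite mul_mx_diag !mxE mulrAC -expr2.
rewrite mulr_ge0 ?sqr_ge0 //; have := h (delta_mx i ord0).
by rewrite -/(bform _ _ _) bform_mxE.
Qed.

Lemma maybe_Diag_diagE d n (N : 'M[R]_n) i : maybe_Diag d N i i = N i i.
Proof. by case: d; rewrite //= !mxE eqxx mulr1n. Qed.

Lemma psd_maybe_Diag d n (N : 'M[R]_n) : psd N -> psd (maybe_Diag d N).
Proof. by case: d => //; apply: psd_Diag. Qed.

Lemma psd_ulsubmx p q (N : 'M[R]_(p + q)) : psd N -> psd (ulsubmx N).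
Proof.
case=> hT h; split=> [|x]; first by rewrite trmx_ulsub hT.
have := h (col_mx x 0); rewrite -!/(bform _ _ _) -{1}[N]submxK bform_block.
by rewrite !bform0l !bform0r !addr0.
Qed.

Lemma psd_drsubmx p q (N : 'M[R]_(p + q)) : psd N -> psd (drsubmx N).
Proof.
case=> hT h; split=> [|x]; first by rewrite trmx_drsub hT.
have := h (col_mx 0 x); rewrite -!/(bform _ _ _) -{1}[N]submxK bform_block.
by rewrite !bform0l !bform0r !add0r.
Qed.

(** * Symmetric-definite pencils have real eigenvectors *)

(** The problem [K w = z P w] is selfadjoint for the inner product of [P].
Splitting [w = a + i b] and [z = s + i t] into real and imaginary parts and
using the symmetry of [K] on the pair [(a, b)] leaves
[t (a^T P a + b^T P b) = 0], so [t = 0]; then [a] and [b] both solve the real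
problem and one of them is nonzero.  With [P = 1] this says that a real
symmetric matrix has real eigenvalues. *)
Lemma real_pencil n (K P : 'M[R]_n) (hK : K^T = K) (hP : spd P) (z : R[i]) :
  eigenvalue (map_mx (real_complex R) (invmx P *m K)) z ->
  exists2 l : R, z = l%:C &
    exists2 w : 'cV[R]_n, w != 0 & K *m w = l *: (P *m w).
Proof.
case/eigenvalueP => v hv v0; have uP := spd_unitmx hP; have [hPT hP0] := hP.
pose toC := real_complex R.
pose a : 'rV[R]_n := \row_i complex.Re (v ord0 i).
pose b : 'rV[R]_n := \row_i complex.Im (v ord0 i).
have ReIm (x y : 'rV[R]_n) i :
    (map_mx toC x + 'i%C *: map_mx toC y) ord0 i = x ord0 i +i* y ord0 i.
  by rewrite !mxE /=; simpc.
have vE : v = map_mx toC a + 'i%C *: map_mx toC b.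
  by apply/rowP => i; rewrite ReIm !mxE; case: (v ord0 i).
case: z hv => s t hv; set M := invmx P *m K in hv; rewrite -/toC in hv.
have /rowP hv' : map_mx toC (a *m M) + 'i%C *: map_mx toC (b *m M) =
    map_mx toC (s *: a - t *: b) + 'i%C *: map_mx toC (s *: b + t *: a).
  have mM c : map_mx toC (c *m M) = map_mx toC c *m map_mx toC M.
    exact: map_mxM.
  rewrite !mM scalemxAl -mulmxDl -vE hv; apply/rowP => i.
  rewrite ReIm vE [LHS]mxE ReIm !mxE; simpc.
  by congr (_ +i* _).
have haM : a *m M = s *: a - t *: b.
  by apply/rowP => i; move: (hv' i); rewrite !ReIm => -[].
have hbM : b *m M = s *: b + t *: a.
  by apply/rowP => i; move: (hv' i); rewrite !ReIm => -[].
(* A row eigenvector v of P^-1 K corresponds to the column P^-1 v^T of the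
   pencil, since K and P are symmetric. *)
pose w (c : 'rV[R]_n) := invmx P *m c^T.
have wP c : P *m w c = c^T by rewrite mulKVmx.
have wK c : K *m w c = (c *m M)^T.
  by rewrite !trmx_mul trmx_inv hK hPT mulmxA.
have hKw : bform K (w b) (w a) = bform K (w a) (w b).
  by rewrite -{1}hK bform_tr.
have hPw : bform P (w b) (w a) = bform P (w a) (w b).
  by rewrite -{1}hPT bform_tr.
have hwa : K *m w a = s *: (P *m w a) + (- t) *: (P *m w b).
  by rewrite wK haM !wP scaleNr linearB !linearZ.
have hwb : K *m w b = s *: (P *m w b) + t *: (P *m w a).
  by rewrite wK hbM !wP linearD !linearZ.
have w0 c : c != 0 -> w c != 0.
  by apply: contra_neq => h; rewrite -[c]trmxK -wP h mulmx0 trmx0.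
have ab0 : (a != 0) || (b != 0).
  rewrite -negb_and; apply: contraNN v0 => /andP[/eqP a0 /eqP b0].
  by rewrite vE a0 b0 !map_mx0 scaler0 addr0.
have [_ hP1] := spd_psd hP.
have t0 : t = 0.
  have e : t * (bform P (w a) (w a) + bform P (w b) (w b)) = 0.
    have := hKw; rewrite ![bform K _ _]bform_mulr hwa hwb.
    rewrite !bformDr !bformZr -!bform_mulr hPw.
    by move=> h; lra.
  move/eqP: e; rewrite mulf_eq0 => /orP[/eqP //|].
  rewrite paddr_eq0 ?hP1 // => /andP[/eqP ea /eqP eb].
  by case/orP: ab0 => /w0/hP0; rewrite -/(bform _ _ _) ?ea ?eb ltxx.
exists s; first by rewrite t0.
move: hwa hwb; rewrite t0 oppr0 !scale0r !addr0 => hwa hwb.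
by case/orP: ab0 => /w0 c0; [exists (w a)|exists (w b)].
Qed.

(** * Spectral measures, square roots and Rayleigh quotients *)

(** If [N = U^* D U] with [U] unitary, then [x^T p(N) x] is the sum of the
[p(d_i) |(U x)_i|^2]: each vector carries nonnegative weights on eigenvalues
of [N], and these weights do not depend on the polynomial [p].  Stated in this
way the diagonalization can be used over the reals although [U] is complex. *)
Lemma spectral_measure n (N : 'M[R]_n.+1) : N^T = N ->
  exists (d : 'I_n.+1 -> R) (w : 'cV[R]_n.+1 -> 'I_n.+1 -> R),
    [/\ forall i, eigenvalue N (d i), forall x i, 0 <= w x i &
        forall p x, bform (horner_mx N p) x x = \sum_i p.[d i] * w x i].
Proof.
move=> hN; pose toC : {rmorphism R -> R[i]} := real_complex R.
pose Nc := map_mx toC N; pose P := spectralmx Nc; pose D := spectral_diag Nc.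
have conjR m k (X : 'M[R]_(m, k)) : map_mx Num.conj (map_mx toC X) = map_mx toC X.
  by apply/matrixP => i j; rewrite !mxE; apply: conjc_real.
have PU : P \is unitarymx := spectral_unitarymx Nc.
have uP : P \in unitmx := spectral_unit Nc.
have NE : Nc = invmx P *m diag_mx D *m P.
  have NT : map_mx Num.conj Nc^T = Nc by rewrite /Nc map_trmx hN conjR.
  by apply/orthomx_spectralP/normalmxP; rewrite NT.
have eigD i : exists2 l, D ord0 i = l%:C & eigenvalue N l.
  have [|l Dl [v v0 hv]] := @real_pencil _ N 1%:M hN (spd1 n.+1) (D ord0 i).
    apply/eigenvalueP; exists (row i P).
      rewrite invmx1 mul1mx -/Nc NE !mulmxA -row_mul mulmxV //.
      by rewrite -row_mul mul1mx row_diag_mx -scalemxAl -rowE.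
    rewrite rowE mulmx_free_eq0 ?row_free_unit //.
    by apply/eqP => /matrixP/(_ ord0 i)/eqP; rewrite !mxE !eqxx oner_eq0.
  exists l => //; apply/eigenvalueP; exists v^T.
    by rewrite -[in LHS]hN -trmx_mul hv mul1mx linearZ.
  by rewrite -trmx0 (inj_eq (@trmx_inj _ _ _)).
pose y (x : 'cV[R]_n.+1) i := (P *m map_mx toC x) i ord0.
exists (fun i => complex.Re (D ord0 i)).
exists (fun x i => complex.Re (y x i) ^+ 2 + complex.Im (y x i) ^+ 2).
split=> [i|x i|p x].
- by have [l -> ] := eigD i.
- by rewrite addr_ge0 ?sqr_ge0.
apply: (@complexI R); rewrite -[_%:C]/(toC _) -[RHS]/(toC _) rmorph_sum /=.
transitivity (((map_mx toC x)^T *m map_mx toC (horner_mx N p) *m map_mx toC x)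
                ord0 ord0).
  by rewrite map_trmx -!map_mxM mxE.
rewrite map_horner_mx -/Nc NE horner_mx_uconjC // horner_mx_diag.
rewrite invmx_unitary // map_trmx -(conjR _ _ x^T) !mulmxA -map_mxM.
rewrite -map_trmx -trmx_mul -!mulmxA mulmxA.
rewrite mul_mx_diag mxE; apply: eq_bigr => i _.
have [l Dl _] := eigD i.
rewrite -[RHS]/(toC _) rmorphM /= /y; move: (P *m _) => Y; rewrite !mxE Dl.
rewrite -[l%:C]/(toC l) horner_map mulrAC -normCKC mulrC; congr (_ * _).
by rewrite -add_Re2_Im2.
Qed.

Lemma poly_interpolation (f : R -> R) (s : seq R) :
  exists p : {poly R}, {in s, forall a, p.[a] = f a}.
Proof.
elim: s => [|a s [p hp]]; first by exists 0.
have [sa|sNa] := boolP (a \in s).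
  by exists p => b; rewrite inE => /predU1P[->|]; apply: hp.
pose q := \prod_(b <- s) ('X - b%:P).
have qa : q.[a] != 0 by rewrite -[_ == 0]/(root q a) root_prod_XsubC.
exists (p + ((f a - p.[a]) / q.[a]) *: q) => b.
rewrite inE hornerD hornerZ => /predU1P[->|sb].
  by rewrite divfK // addrC subrK.
have /eqP -> : root q b by rewrite root_prod_XsubC.
by rewrite mulr0 addr0 hp.
Qed.

Lemma tr_horner_mx n (N : 'M[R]_n.+1) p : N^T = N ->
  (horner_mx N p)^T = horner_mx N p.
Proof.
move=> hN; elim/poly_ind: p => [|p c ih]; first by rewrite rmorph0 trmx0.
rewrite rmorphD rmorphM /= horner_mx_X horner_mx_C linearD /= tr_scalar_mx.
by rewrite trmx_mul ih hN; congr (_ + _); apply: comm_mx_horner.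
Qed.

Lemma bform1_eigen n (N : 'M[R]_n) a : eigenvalue N a ->
  exists2 x : 'cV_n, 0 < bform 1%:M x x & bform N x x = a * bform 1%:M x x.
Proof.
case/eigenvalueP => v hv v0; exists v^T.
  have [_] := spd1 n; apply.
  by rewrite -trmx0 (inj_eq (@trmx_inj _ _ _)).
by rewrite /bform trmxK hv mulmx1 -scalemxAl mxE.
Qed.

(** The root is [p(N)] for a polynomial [p] that interpolates the square root
on the eigenvalues.  It is symmetric as a polynomial in [N], it is positive
definite because the values of [p] there are positive, and [T = p(N)^2 - N] vanishes because the
spectral measure gives [|T x|^2 = 0] for every [x]. *)
Lemma spd_sqrt_exists n (N : 'M[R]_n) : spd N ->
  exists S : 'M[R]_n, spd S /\ S *m S = N.
Proof.
case: n N => [|n] N hN.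
  by exists N; split=> //; rewrite [N]flatmx0 mulmx0.
have [hT h] := hN.
have [d [w [hd hw hp]]] := spectral_measure hT.
have d0 i : 0 < d i.
  have [x x0 hx] := bform1_eigen (hd i).
  rewrite -(pmulr_lgt0 _ x0) -hx; apply: h.
  by apply: contraTneq x0 => ->; rewrite bform0l ltxx.
have [p pE] := poly_interpolation Num.sqrt [seq d i | i <- enum 'I_n.+1].
have pd i : p.[d i] = Num.sqrt (d i).
  by apply: pE; apply: map_f; rewrite mem_enum.
have ST := tr_horner_mx p hT.
exists (horner_mx N p); split; last first.
  apply/eqP; rewrite -subr_eq0; apply/eqP.
  set T := _ - _; have TE : T = horner_mx N (p * p - 'X).
    by rewrite rmorphB rmorphM /= horner_mx_X.
  apply/matrixP => i j; suff T0 (x : 'cV_n.+1) : T *m x = 0.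
    by have /matrixP/(_ i ord0) := T0 (delta_mx j ord0); rewrite -colE !mxE.
  apply: bform1_eq0.
  have -> : bform 1%:M (T *m x) (T *m x) =
            bform (horner_mx N ((p * p - 'X) * (p * p - 'X))) x x.
    by rewrite rmorphM /= -TE bform1_mul TE tr_horner_mx.
  rewrite hp big1 // => k _; rewrite !hornerE pd -!expr2 sqr_sqrtr ?ltW //.
  by rewrite subrr expr0n mul0r.
split=> // x x0; rewrite -/(bform _ _ _) hp lt_def; apply/andP; split.
  have: bform 1%:M x x != 0 by apply: contra_neq x0; apply: bform1_eq0.
  have -> : bform 1%:M x x = \sum_i w x i.
    rewrite -(horner_mx_C N 1) hp.
    by apply: eq_bigr => i _; rewrite hornerC mul1r.
  apply: contraNneq => /eqP; rewrite psumr_eq0 => [/allP h0|i _]; last first.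
    by rewrite pd mulr_ge0 ?sqrtr_ge0.
  apply/eqP/big1 => i _; have := h0 i (mem_index_enum i).
  by rewrite pd mulf_eq0 gt_eqF ?sqrtr_gt0 //= => /eqP.
by rewrite sumr_ge0 // => i _; rewrite pd mulr_ge0 ?sqrtr_ge0.
Qed.

Lemma spd_sqrtP n (N : 'M[R]_n) : spd N ->
  spd (spd_sqrt N) /\ spd_sqrt N *m spd_sqrt N = N.
Proof. by move=> /spd_sqrt_exists; apply: xgetPex. Qed.

(** In dimension 0 all forms vanish, whatever the default values of
[lambda_min] and [lambda_max].  Otherwise the least and the greatest node of
the spectral measure are the extreme eigenvalues, and both bounds compare
weighted sums. *)
Lemma rayleigh_bounds n (N : 'M[R]_n) (x : 'cV_n) : N^T = N ->
  lambda_min N * bform 1%:M x x <= bform N x x /\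
  bform N x x <= lambda_max N * bform 1%:M x x.
Proof.
case: n N x => [|n] N x hN.
  by rewrite [x]flatmx0 !bform0l !mulr0.
have [d [w [hd hw hp]]] := spectral_measure hN.
have e1 y : bform 1%:M y y = \sum_i w y i.
  rewrite -(horner_mx_C N 1) hp.
  by apply: eq_bigr => i _; rewrite hornerC mul1r.
have eN y : bform N y y = \sum_i d i * w y i.
  rewrite -{1}(horner_mx_X N) hp.
  by apply: eq_bigr => i _; rewrite hornerX.
have lower a y : (forall i, a <= d i) -> a * bform 1%:M y y <= bform N y y.
  move=> ha; rewrite e1 eN mulr_sumr ler_sum // => i _.
  by rewrite ler_wpM2r.
have upper a y : (forall i, d i <= a) -> bform N y y <= a * bform 1%:M y y.
  move=> ha; rewrite e1 eN mulr_sumr ler_sum // => i _.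
  by rewrite ler_wpM2r.
split.
  have [i _ hi] := arg_minP d (isT : predT (ord0 : 'I_n.+1)).
  have [hm1 hm2] : eigenvalue N (lambda_min N) /\
      forall b, eigenvalue N b -> lambda_min N <= b.
    apply: (@xgetPex _ 0 [set a : R | eigenvalue N a /\
                      forall b, eigenvalue N b -> a <= b]%classic).
    exists (d i); split=> // b /bform1_eigen[y y0 yb].
    rewrite -(ler_pM2r y0) -yb; apply: lower => j; exact: hi.
  by apply: lower => j; apply: hm2.
have [i _ hi] := arg_maxP d (isT : predT (ord0 : 'I_n.+1)).
have [hm1 hm2] : eigenvalue N (lambda_max N) /\
    forall b, eigenvalue N b -> b <= lambda_max N.
  apply: (@xgetPex _ 0 [set a : R | eigenvalue N a /\
                    forall b, eigenvalue N b -> b <= a]%classic).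
  exists (d i); split=> // b /bform1_eigen[y y0 yb].
  rewrite -(ler_pM2r y0) -yb; apply: upper => j; exact: hi.
by apply: upper => j; apply: hm2.
Qed.

(** Substitution of [P^(1/2) x] in the Rayleigh bounds of the scaled matrix. *)
Lemma scaled_rayleigh_bounds n (P N : 'M[R]_n) (x : 'cV_n) :
  spd P -> N^T = N ->
  let Nt := spd_isqrt P *m N *m spd_isqrt P in
  lambda_min Nt * bform P x x <= bform N x x /\
  bform N x x <= lambda_max Nt * bform P x x.
Proof.
move=> hP hN; have [hS SS] := spd_sqrtP hP.
have uS := spd_unitmx hS; have [ST _] := hS.
have VT : (spd_isqrt P)^T = spd_isqrt P by rewrite trmx_inv ST.
move=> Nt; have NtT : Nt^T = Nt by rewrite !trmx_mul VT hN mulmxA.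
have := rayleigh_bounds (spd_sqrt P *m x) NtT.
have -> : bform 1%:M (spd_sqrt P *m x) (spd_sqrt P *m x) = bform P x x.
  by rewrite bform1_mul ST SS.
by rewrite /Nt bform_mul VT mulKmx.
Qed.

(** * Eigenvalue bounds for preconditioned saddle-point systems *)

Lemma ler_sqrt_sqr (s t : R) : 0 <= s -> s ^+ 2 <= t -> s <= Num.sqrt t.
Proof.
move=> s0 st; rewrite -(ger0_norm s0) -sqrtr_sqr ler_sqrt //.
exact: le_trans (sqr_ge0 s) st.
Qed.

Lemma pmul_le0_eq0 (s t : R) : 0 < s -> 0 <= t -> s * t <= 0 -> t = 0.
Proof. by move=> s0 t0; rewrite pmulr_rle0 // => t1; apply/le_anti/andP. Qed.

(** Suppose [- l > bF].  Both [(- l - bF) f] and [- l p] are at most [- c].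
Multiplying these two
bounds and using [c^2 <= f g <= bN f p] gives [l (l + bF) <= bN], hence
[(- l - bF)^2 <= bN]. *)
Lemma negative_branch (a f c e p g l bF bN : R) :
  c = l * f + a -> c + e = l * p -> 0 <= f -> 0 <= e -> 0 <= p -> 0 < f + p ->
  a <= bF * f -> g + e <= bN * p -> c ^+ 2 <= f * g -> 0 <= bF ->
  - bF - Num.sqrt bN <= l.
Proof.
move=> hc he f0 e0 p0 fp af gp cs b0; have := sqrtr_ge0 bN.
have [lb|lb] := leP (- bF) l; first by lra.
set mu := - l; suff : mu - bF <= Num.sqrt bN by rewrite /mu; lra.
have mub : bF < mu by rewrite /mu; lra.
have cf : (mu - bF) * f <= - c by rewrite /mu; nra.
have cp : mu * p <= - c by rewrite /mu; nra.
have mf0 : 0 <= (mu - bF) * f by rewrite mulr_ge0 // subr_ge0 ltW.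
have mp0 : 0 <= mu * p by rewrite mulr_ge0 //; lra.
have c0 : 0 < - c.
  rewrite lt_def (le_trans mp0 cp) andbT; apply/eqP => c0.
  have f1 : f = 0 by apply: (@pmul_le0_eq0 (mu - bF)) => //; lra.
  have p1 : p = 0 by apply: (@pmul_le0_eq0 mu) => //; lra.
  by lra.
have c2 : 0 < c ^+ 2 by rewrite -sqrrN exprn_gt0.
have p1 : 0 < p.
  rewrite lt_def p0 andbT; apply/eqP => p1.
  have g1 : g <= 0 by move: gp; rewrite p1 mulr0; lra.
  by have := le_trans cs (mulr_ge0_le0 f0 g1); lra.
have cs' : c ^+ 2 <= f * (bN * p).
  by apply: le_trans cs _; rewrite ler_wpM2l //; lra.
have fc : ((mu - bF) * f) * (mu * p) <= (- c) * (- c) by apply: ler_pM.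
have bN0 : 0 <= bN.
  rewrite -(pmulr_lge0 _ p1); apply: le_trans gp.
  have : 0 < f * g := lt_le_trans c2 cs.
  by have [g0|g0] := leP 0 g; [lra | nra].
apply: ler_sqrt_sqr; first by rewrite subr_ge0 ltW.
have : (mu - bF) * mu <= bN.
  rewrite -(ler_pM2r c2).
  have : (mu - bF) * mu * c ^+ 2 <= (mu - bF) * mu * (f * (bN * p)).
    rewrite ler_wpM2l // mulr_ge0 //; lra.
  move/le_trans; apply.
  have -> : (mu - bF) * mu * (f * (bN * p)) = bN * (((mu - bF) * f) * (mu * p)).
    by ring.
  rewrite ler_wpM2l //; apply: le_trans fc _; rewrite mulrNN expr2 //.
by nra.
Qed.

(** For the lower bound, [l (l + bF) p = (l + bF) (c + e) >= g + e], where
[l + bF >= 1] is what absorbs [e].  For the upper bound, [c^2 <= f g] and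
[l f <= c] give [l c <= g]; then [l (l p - e) <= bN p - e], and [e <= p] turns
this into [l^2 - bN <= l - 1] when [l > 1]. *)
Lemma positive_branch (a f c e p g l aF bF aN bN : R) :
  c = l * f + a -> c + e = l * p -> 0 <= f -> 0 <= a -> 0 <= g -> 0 <= p ->
  0 < f + p -> (0 < p -> 0 < e) -> e <= p -> 0 <= e ->
  aF * f <= a -> aN * p <= g + e -> g + e <= bN * p ->
  c ^+ 2 <= f * g -> (0 < l -> g <= (l + bF) * c) -> 1 <= bF -> - aF < l ->
  2^-1 * (- bF + Num.sqrt (bF ^+ 2 + 4 * aN)) <= l /\
  l <= 1 + Num.sqrt (bN - 1).
Proof.
move=> hc he f0 a0 g0 p0 fp ep ep' e0 af pa pb cs gc b1 la.
have c1 : (l + aF) * f <= c by rewrite hc mulrDl; lra.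
have c0 : 0 <= c by apply: le_trans c1; rewrite mulr_ge0 //; lra.
have p1 : 0 < p.
  rewrite lt_def p0 andbT; apply/eqP => p1.
  have cz : c = 0 by nra.
  have : 0 < (l + aF) * f by rewrite mulr_gt0; lra.
  lra.
have l0 : 0 < l by rewrite -(pmulr_lgt0 _ p1); have := ep p1; lra.
have {}gc := gc l0; split.
  suff : Num.sqrt (bF ^+ 2 + 4 * aN) <= 2 * l + bF by lra.
  have s0 : 0 <= 2 * l + bF by lra.
  rewrite -(ger0_norm s0) -sqrtr_sqr ler_wsqrtr //.
  suff : aN <= l * (l + bF) by nra.
  rewrite -(ler_pM2r p1); apply: le_trans pa _.
  have -> : l * (l + bF) * p = (l + bF) * (c + e) by rewrite he; ring.
  rewrite mulrDr; apply: lerD gc _; rewrite ler_peMl //; lra.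
have [l1|l1] := leP l 1; first by have := sqrtr_ge0 (bN - 1); lra.
suff : l - 1 <= Num.sqrt (bN - 1) by lra.
apply: ler_sqrt_sqr; first by lra.
have lcg : l * c <= g.
  have [->|cn0] := eqVneq c 0; first by rewrite mulr0.
  have c2 : 0 < c by rewrite lt_def cn0.
  rewrite -(ler_pM2r c2).
  have -> : l * c * c = l * c ^+ 2 by ring.
  apply: le_trans (_ : l * (f * g) <= _); first by rewrite ler_pM2l.
  by rewrite mulrA mulrC ler_wpM2l //; lra.
suff : l ^+ 2 - bN <= l - 1 by nra.
rewrite -(ler_pM2r p1).
have h1 : l * c = l ^+ 2 * p - l * e.
  have -> : c = l * p - e by lra.
  by ring.
have h2 : e * (l - 1) <= p * (l - 1) by rewrite ler_wpM2r //; lra.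
nra.
Qed.

(** The bounds hold for any positive definite block preconditioner whose lower
block dominates [delta]: the shape of the blocks enters only through the
constants [aF], [bF], [aN], [bN] and the condition [1 <= bF]. *)
Lemma saddle_bounds m n (A : 'M[R]_(m, n)) (F Fh : 'M[R]_n) (P : 'M[R]_m)
    (delta aF bF aN bN l : R) (x : 'cV_n) (y : 'cV_m) :
  psd F -> spd Fh -> 0 < delta -> psd (P - delta%:M) ->
  (forall u, aF * bform Fh u u <= bform F u u /\
             bform F u u <= bF * bform Fh u u) ->
  (forall v, aN * bform P v v <= bform (A *m invmx Fh *m A^T + delta%:M) v v /\
             bform (A *m invmx Fh *m A^T + delta%:M) v v <= bN * bform P v v) ->
  1 <= bF -> (x != 0) || (y != 0) ->
  - F *m x + A^T *m y = l *: (Fh *m x) ->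
  A *m x + delta%:M *m y = l *: (P *m y) ->
  (- bF - Num.sqrt bN <= l /\ l <= - aF) \/
  (2^-1 * (- bF + Num.sqrt (bF ^+ 2 + 4 * aN)) <= l /\
  l <= 1 + Num.sqrt (bN - 1)).
Proof.
move=> hF hFh d0 hP rF rM b1 xy e1 e2.
have uFh := spd_unitmx hFh; have [FhT _] := hFh; have [_ F0] := hF.
have [_ Fh0] := spd_psd hFh; have [_ P0] := hP.
(* v represents A^T y in the inner product of Fh, so that both Cauchy-Schwarz
   estimates below are about x and v. *)
pose v := invmx Fh *m (A^T *m y).
have vE : Fh *m v = A^T *m y by rewrite /v mulKVmx.
pose f := bform Fh x x; pose a := bform F x x; pose c := bform A y x.
pose e := delta * bform 1%:M y y; pose p := bform P y y.
pose g := bform Fh v v.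
have cE : c = bform A^T x y by rewrite bform_tr.
have hc : c = l * f + a.
  have := congr1 (bform 1%:M x) e1.
  rewrite bformDr bformZr -!bform_mulr bformN -cE -/f -/a => h; lra.
have he : c + e = l * p.
  have := congr1 (bform 1%:M y) e2.
  by rewrite bformDr bformZr -!bform_mulr bform_scalar.
have gE : g = bform (A *m invmx Fh *m A^T) y y.
  by rewrite bform_mul -vE -{2}FhT -bform_mul mulmxV // mul1mx.
have f0 : 0 <= f := Fh0 x.
have a0 : 0 <= a := F0 x.
have g0 : 0 <= g := Fh0 v.
have e0 : 0 <= e by rewrite mulr_ge0 ?bform1_ge0 // ltW.
have ep : e <= p.
  by have := P0 y; rewrite -/(bform _ _ _) bformD bformN bform_scalar subr_ge0.
have p0 : 0 <= p := le_trans e0 ep.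
have y0 : y != 0 -> 0 < e.
  by move=> yn; rewrite mulr_gt0 //; have [_] := spd1 m; apply.
have fp : 0 < f + p.
  case/orP: xy => [xn|/y0 e1']; last by lra.
  have [_ Fh1] := hFh; have f1 : 0 < f := Fh1 x xn.
  by lra.
have pe : 0 < p -> 0 < e.
  move=> p1; apply: y0; apply: contraTneq p1 => yz.
  by rewrite /p yz bform0l ltxx.
have [Fa Fb] := rF x; have [Ma Mb] := rM y.
rewrite bformD bform_scalar -gE -/e -/p in Ma Mb.
have cs : c ^+ 2 <= f * g.
  have -> : c = bform Fh x v by rewrite cE bform_mulr -vE -bform_mulr.
  exact: psd_cauchy_schwarz (spd_psd hFh) _ _.
have gc : 0 < l -> g <= (l + bF) * c.
  (* The first equation says H x = A^T y, so v^T H x = g and x^T H x = c;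
     moreover H <= (l + bF) Fh, so v^T H v <= (l + bF) g. *)
  move=> l0; pose H := l *: Fh + F.
  have HT : H^T = H by rewrite linearD linearZ /= FhT; case: hF => ->.
  have Hq u : bform H u u = l * bform Fh u u + bform F u u.
    by rewrite bformD bformZ.
  have hH : psd H.
    split=> // u; rewrite -/(bform _ _ _) Hq addr_ge0 //; last exact: F0.
    by apply: mulr_ge0; [exact: ltW | exact: Fh0].
  have Hx : H *m x = A^T *m y.
    rewrite mulmxDl -scalemxAl -e1 mulNmx addrAC addNr add0r //.
  have Hxx : bform H x x = c by rewrite bform_mulr Hx -bform_mulr -cE.
  have Hvx : bform H v x = g by rewrite bform_mulr Hx -vE -bform_mulr.
  have := psd_cauchy_schwarz hH v x; rewrite Hvx Hxx => csH.
  have [_ Fv] := rF v; rewrite -/g in Fv.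
  have Hvv : bform H v v <= (l + bF) * g by rewrite Hq mulrDl -/g lerD2l.
  have c0 : 0 <= c by rewrite -Hxx; case: hH => _; apply.
  have [gz|gn] := eqVneq g 0; first by rewrite gz mulr_ge0 //; lra.
  have g1 : 0 < g by rewrite lt_def gn.
  rewrite -(ler_pM2r g1) -expr2; apply: le_trans csH _.
  by rewrite mulrAC ler_wpM2r.
have [la|la] := leP l (- aF); [left|right].
  by split=> //; apply: (negative_branch hc he) cs _ => //; lra.
exact: (positive_branch hc he f0 a0 g0 p0 fp pe ep e0 Fa Ma Mb cs gc b1 la).
Qed.

(** * The two preconditioner blocks *)

Lemma perm_mx_tr_mul n (P : 'M[R]_n) : is_perm_mx P -> P^T *m P = 1%:M.
Proof.
by case/is_perm_mxP => s ->; rewrite tr_perm_mx -perm_mxM mulVg perm_mx1.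
Qed.

Lemma psd_Qhat kc nc d1 d2 (Pc Q : 'M[R]_(kc + nc)) :
  psd Q -> psd (Qhat d1 d2 Pc Q).
Proof.
move=> hQ; apply: psd_congr; have hQp : psd (Pc^T *m Q *m Pc).
  by rewrite -{2}[Pc]trmxK; apply: psd_congr.
apply: psd_block; apply: psd_maybe_Diag; [exact: psd_ulsubmx|exact: psd_drsubmx].
Qed.

(** In permuted coordinates [Qhat] and [Q] have the same diagonal, so their
quadratic forms agree on the columns of [Pc]. *)
Lemma bform_Qhat_perm_col kc nc d1 d2 (Pc Q : 'M[R]_(kc + nc)) i :
  is_perm_mx Pc ->
  let u := Pc *m delta_mx i ord0 in bform (Qhat d1 d2 Pc Q) u u = bform Q u u.
Proof.
move=> hPc u; rewrite /Qhat bform_mul.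
have -> : Pc^T *m u = delta_mx i ord0 by rewrite mulmxA perm_mx_tr_mul ?mul1mx.
rewrite bform_mxE /u.
have -> : bform Q (Pc *m delta_mx i ord0) (Pc *m delta_mx i ord0) =
    (Pc^T *m Q *m Pc) i i by rewrite -bform_mxE bform_mul trmxK.
set Qp := _ *m Pc.
case: (split_ordP i) => j ->.
  by rewrite block_mxEul maybe_Diag_diagE !mxE.
by rewrite block_mxEdr maybe_Diag_diagE !mxE.
Qed.

(** Subtracting [B21 B21^T] from the lower block leaves the Gram matrix
[B22 B22^T], so both blocks of the difference are sums of Gram matrices, for
any [B]. *)
Lemma psd_P_NE_sub_scalar kc nc kr mr (A : 'M[R]_(kr + mr, kc + nc)) Fh
    delta Pc Pr :
  psd (P_NE A Fh delta Pc Pr - delta%:M).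
Proof.
rewrite /P_NE; set B := _ *m Pc.
rewrite scalar_mx_block opp_block_mx add_block_mx !subr0.
apply: psd_block.
  by rewrite addrK; apply: psdD; apply: psd_gram.
by rewrite addrAC addrK [X in X - _]addrC addrK; apply: psd_gram.
Qed.

End Preconditioning.

Theorem theorem3p1 (R : realType) (kc nc kr mr : nat)
    (hmn : (kr + mr <= kc + nc)%N)
    (A : 'M[R]_(kr + mr, kc + nc)) (Q : 'M[R]_(kc + nc)) (hQ : psd Q)
    (delta rho : R) (hdelta : 0 < delta) (hrho : 0 < rho)
    (Pc : 'M[R]_(kc + nc)) (hPc : is_perm_mx Pc)
    (Pr : 'M[R]_(kr + mr)) (hPr : is_perm_mx Pr)
    (d1 d2 : bool) :
  let F := Q + rho%:M in
  let Fhat := Qhat d1 d2 Pc Q + rho%:M in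
  let PNE := P_NE A Fhat delta Pc Pr in
  let Ftilde := spd_isqrt Fhat *m F *m spd_isqrt Fhat in
  let MtildeNE := spd_isqrt PNE *m Mhat A Fhat delta *m spd_isqrt PNE in
  let alphaNE := lambda_min MtildeNE in
  let betaNE := lambda_max MtildeNE in
  let alphaF := lambda_min Ftilde in
  let betaF := lambda_max Ftilde in
  let K := block_mx (- F) A^T A delta%:M in
  let PAS := block_mx Fhat 0 0 PNE in
  forall z : R[i],
    eigenvalue (map_mx (real_complex R) (invmx PAS *m K)) z ->
    exists2 x : R, z = x%:C &
      x \in `[- betaF - Num.sqrt betaNE, - alphaF] \/
      x \in `[2^-1 * (- betaF + Num.sqrt (betaF ^+ 2 + 4 * alphaNE)),
              1 + Num.sqrt (betaNE - 1)].
Proof.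
move=> F Fhat PNE Ftilde MtildeNE alphaNE betaNE alphaF betaF K PAS z hz.
have hF : spd F by apply: spd_add_scalar.
have hFh : spd Fhat by apply: spd_add_scalar => //; apply: psd_Qhat.
have shiftP : psd (PNE - delta%:M) by apply: psd_P_NE_sub_scalar.
have hP : spd PNE by rewrite -[PNE](subrK delta%:M); apply: spd_add_scalar.
have hM : (Mhat A Fhat delta)^T = Mhat A Fhat delta.
  rewrite /Mhat linearD /= tr_scalar_mx !trmx_mul trmxK mulmxA.
  by have [->] := spd_inv hFh.
have hK : K^T = K.
  rewrite tr_block_mx trmxK tr_scalar_mx linearN /=.
  by have [->] := hF.
have [l zl [w w0 hw]] := real_pencil hK (spd_block hFh hP) hz.
have b1 : 1 <= betaF.
  (* In dimension n = 0 there would be no column; there m <= n leaves no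
     eigenvector at all. *)
  have n0 : (0 < kc + nc)%N.
    rewrite lt0n; apply: contraNneq w0 => n0.
    have m0 : (kr + mr = 0)%N by move: hmn; rewrite n0 leqn0 => /eqP.
    apply/eqP/colP => -[i hi]; exfalso; move: hi; by rewrite n0 m0.
  pose u : 'cV[R]_(kc + nc) := Pc *m delta_mx (Ordinal n0) ord0.
  have FFh : bform F u u = bform Fhat u u.
    by rewrite !bformD bform_Qhat_perm_col.
  have u0 : u != 0.
    apply/eqP => /(congr1 (mulmx Pc^T)).
    rewrite mulmxA perm_mx_tr_mul // mul1mx mulmx0 => /matrixP.
    by move/(_ (Ordinal n0) ord0)/eqP; rewrite !mxE !eqxx oner_eq0.
  have Fu : 0 < bform Fhat u u by case: hFh => _; apply.
  have [_] := scaled_rayleigh_bounds u hFh (proj1 hF).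
  by rewrite -/Ftilde -/betaF FFh -{1}[bform _ _ _]mul1r ler_pM2r.
move: w0 hw; rewrite -[w]vsubmxK; move: (usubmx w) (dsubmx w) => x y.
rewrite col_mx_eq0 negb_and => xy.
rewrite !mul_block_col !mul0mx addr0 add0r scale_col_mx => /eq_col_mx[e1 e2].
exists l => //; rewrite !in_itv /=.
have := saddle_bounds (spd_psd hF) hFh hdelta shiftP
  (fun u => scaled_rayleigh_bounds u hFh (proj1 hF))
  (fun v => scaled_rayleigh_bounds v hP hM) b1 xy e1 e2.
by case=> -[/[swap] h1 h2]; [left|right]; apply/andP.
Qed.
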